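(* Let $n$ be a positive integer, let $c,x_*\in\mathbb{R}^n$, $d\in\mathbb{R}$, $\delta\ge 0$, let $M\in\mathbb{R}^{n\times n}$ be positive semidefinite, and let $f:\mathbb{R}^n\to\mathbb{R}$ be defined by $$f(x)=c^Tx+d-\sqrt{\delta^2+(x-x_* )^TM(x-x_* )}.$$ Then $f$ is strictly concave if and only if $M$ is positive definite and $\delta>0$.
   Context: A positive semidefinite (respectively positive definite) matrix is a real symmetric matrix with all eigenvalues non-negative (respectively positive). A function $f:\mathbb{R}^n\to\mathbb{R}$ is strictly concave if $f((1-t)x_0+tx_1)>(1-t)f(x_0)+tf(x_1)$ for all $x_0\ne x_1$ in $\mathbb{R}^n$ and all $t\in(0,1)$. *)

(* Defs.v *)
From mathcomp Require Import all_boot all_order all_algebra.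
From mathcomp Require Import reals.

Set Implicit Arguments.
Unset Strict Implicit.
Unset Printing Implicit Defensive.

Import Order.TTheory GRing.Theory Num.Theory.

Local Open Scope ring_scope.

(* [eigenvalue] refers to eigenvalues in R with row eigenvectors,
   v *m M = a *: v; since M is symmetric these are also the eigenvalues for
   column eigenvectors, and all complex eigenvalues of M lie in R. *)
Definition psdmx (R : realType) (n : nat) (M : 'M[R]_n) : Prop :=
  M \is symmetricmx /\ (forall a : R, eigenvalue M a -> 0 <= a).

Definition pdmx (R : realType) (n : nat) (M : 'M[R]_n) : Prop :=
  M \is symmetricmx /\ (forall a : R, eigenvalue M a -> 0 < a).

Definition strictly_concave (R : realType) (n : nat) (f : 'cV[R]_n -> R) :
    Prop :=
  forall (x0 x1 : 'cV[R]_n) (t : R), x0 != x1 -> 0 < t < 1 ->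
    f ((1 - t) *: x0 + t *: x1) > (1 - t) * f x0 + t * f x1.

(* Main.v *)
Require Import Defs.
From mathcomp Require Import all_boot all_order all_algebra.
From mathcomp Require Import reals.
From mathcomp Require Import complex ring lra.

Set Implicit Arguments.
Unset Strict Implicit.

Import Order.TTheory GRing.Theory Num.Theory.

Local Open Scope ring_scope.
Local Open Scope sesquilinear_scope.

(** Put q(y) = y^T M y, so that f is an affine function minus
    sqrt (delta^2 + q(x - xs)).

    Sufficiency.  When M is positive definite, the spectral theorem over the
    complex numbers turns q into a sum of squared moduli weighted by the
    eigenvalues, so q is positive away from 0 (lemma [pdmx_quad_gt0]) and the
    associated bilinear form b satisfies the Cauchy-Schwarz inequality.
    Squaring the convexity inequality for the square root at u and v reduces it
    to delta^2 + b(u, v) < sqrt (delta^2 + q(u)) * sqrt (delta^2 + q(v)).  The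
    difference of the squares of the two sides is
    delta^2 * q(u - v) + (q(u) q(v) - b(u, v)^2), whose first
    term is positive for u <> v and delta > 0, and whose second term is
    nonnegative by Cauchy-Schwarz (lemma [sqrt_quad_convex]).

    Necessity.  A strictly concave function is not affine on any segment.  If
    delta = 0, the square root is positively homogeneous of degree 1 in x - xs,
    so f is affine on every half-line issued from xs.  If M is semidefinite but
    not definite, 0 is an eigenvalue; along an eigenvector q vanishes, so f is
    affine on the corresponding line through xs. *)

(** * Bilinear and quadratic forms of a matrix *)

Definition mxform (R : realType) (n : nat) (M : 'M[R]_n) (x y : 'cV[R]_n) : R :=
  (x^T *m M *m y) ord0 ord0.

Section MxForm.
Variables (R : realType) (n : nat) (M : 'M[R]_n).
Implicit Types (x y z : 'cV[R]_n) (a : R).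

Lemma mxformDl x y z : mxform M (x + y) z = mxform M x z + mxform M y z.
Proof. by rewrite /mxform raddfD /= !mulmxDl mxE. Qed.

Lemma mxformDr x y z : mxform M x (y + z) = mxform M x y + mxform M x z.
Proof. by rewrite /mxform mulmxDr mxE. Qed.

Lemma mxformZl a x y : mxform M (a *: x) y = a * mxform M x y.
Proof. by rewrite /mxform linearZ /= -!scalemxAl mxE. Qed.

Lemma mxformZr a x y : mxform M x (a *: y) = a * mxform M x y.
Proof. by rewrite /mxform -scalemxAr mxE. Qed.

Lemma mxform0l y : mxform M 0 y = 0.
Proof. by rewrite -(scale0r (0 : 'cV_n)) mxformZl mul0r. Qed.

Lemma symmetricmx_tr : M \is symmetricmx -> M^T = M.
Proof. by rewrite is_hermitianmxE expr0 scale1r map_mx_id // => /eqP. Qed.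

Lemma mxformC x y : M \is symmetricmx -> mxform M x y = mxform M y x.
Proof.
move=> /symmetricmx_tr Msym; rewrite /mxform.
rewrite -[in LHS](trmxK (_ *m y)) mxE.
by rewrite !trmx_mul trmxK Msym mulmxA.
Qed.

Lemma mxform_comb a b x y : M \is symmetricmx ->
  mxform M (a *: x + b *: y) (a *: x + b *: y) =
  a ^+ 2 * mxform M x x + 2 * (a * b) * mxform M x y + b ^+ 2 * mxform M y y.
Proof.
move=> Msym; rewrite !(mxformDl, mxformDr, mxformZl, mxformZr).
rewrite (mxformC y x) //; ring.
Qed.

End MxForm.

(** * Positive definite matrices have positive quadratic forms *)

Lemma complexified_real (R : realType) (m n : nat) (A : 'M[R]_(m, n)) :
  map_mx (real_complex R) A \is a realmx.
Proof.
by apply/mxOverP => i j; rewrite mxE; apply/complex_realP; exists (A i j).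
Qed.

Lemma complexified_symmetric (R : realType) (n : nat) (M : 'M[R]_n) :
  M \is symmetricmx -> map_mx (real_complex R) M \is symmetricmx.
Proof.
move=> Msym; rewrite is_hermitianmxE expr0 scale1r map_mx_id //.
by rewrite map_trmx (symmetricmx_tr Msym).
Qed.

(** A diagonal entry of the spectral decomposition is an eigenvalue of the
    complexified matrix, hence a root of a polynomial with real coefficients;
    being real by symmetry, it is an eigenvalue of the original matrix. *)
Lemma spectral_diag_gt0 (R : realType) (n : nat) (M : 'M[R]_n) (i : 'I_n) :
  pdmx M -> 0 < spectral_diag (map_mx (real_complex R) M) 0 i.
Proof.
move=> [Msym Mpos]; set MC := map_mx _ M.
have MCreal : MC \is a realmx by exact: complexified_real.
have MCsym : MC \is symmetricmx by exact: complexified_symmetric.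
have MCnormal := symmetric_normalmx MCsym MCreal.
have Dreal := hermitian_spectral_diag_real (realsym_hermsym MCsym MCreal).
have /complex_realP[k Dk] := mxOverP Dreal 0 i.
rewrite Dk ltcR; apply: Mpos.
rewrite eigenvalue_root_char -(fmorph_root (real_complex R)) map_char_poly.
rewrite -eigenvalue_root_char -/MC /= -Dk.
have PM : spectralmx MC *m MC = diag_mx (spectral_diag MC) *m spectralmx MC.
  rewrite [X in _ *m X = _](orthomx_spectralP MCnormal).
  by rewrite !mulmxA mulmxV ?spectral_unit // mul1mx.
apply/eigenvalueP; exists (row i (spectralmx MC)).
  by rewrite -row_mul PM mul_diag_mx; apply/rowP => j; rewrite !mxE.
apply: contraTneq (spectral_unit MC) => rowi0.
rewrite unitmxE (expand_det_row _ i) big1 ?unitr0 // => j _.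
by have /rowP/(_ j) := rowi0; rewrite !mxE => ->; rewrite mul0r.
Qed.

(** In the orthonormal basis given by the spectral theorem, the form is the sum
    of the squared moduli of the coordinates weighted by the eigenvalues. *)
Lemma pdmx_quad_gt0 (R : realType) (n : nat) (M : 'M[R]_n) (x : 'cV[R]_n) :
  pdmx M -> x != 0 -> 0 < mxform M x x.
Proof.
move=> Mpd x_neq0; have [Msym _] := Mpd.
set toC := real_complex R; set MC := map_mx toC M; set P := spectralmx MC.
set D := spectral_diag MC; set y := P *m map_mx toC x.
have MCnormal : MC \is normalmx.
  by apply: symmetric_normalmx; [exact: complexified_symmetric
                                |exact: complexified_real].
have MCE : MC = P^t* *m diag_mx D *m P.
  rewrite -(invmx_unitary (spectral_unitarymx MC)).
  exact: (orthomx_spectralP MCnormal).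
(* x has real entries, so conjugation only affects the unitary factor *)
have yE : y^t* = (map_mx toC x)^T *m P^t*.
  rewrite /y trmx_mul map_mxM; congr (_ *m _).
  by rewrite map_trmx realmxC // complexified_real.
have formE : toC (mxform M x x) = \sum_i D 0 i * `|y i 0| ^+ 2.
  have -> : toC (mxform M x x) = (y^t* *m diag_mx D *m y) 0 0.
    have -> : toC (mxform M x x) =
        ((map_mx toC x)^T *m MC *m map_mx toC x) 0 0.
      by rewrite map_trmx -!map_mxM mxE.
    by rewrite MCE yE /y !mulmxA.
  rewrite mxE; apply: eq_bigr => i _.
  by rewrite mul_mx_diag !mxE normCK; ring.
have Dpos i : 0 < D 0 i by exact: spectral_diag_gt0.
have [i yi_neq0] : exists i, y i 0 != 0.
  apply/existsP; apply: contraNT x_neq0 => /existsPn y0.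
  have {}y0 : y = 0.
    by apply/colP => i; rewrite [RHS]mxE; apply/eqP/negPn/y0.
  have /eqP : map_mx toC x = 0.
    by rewrite -[LHS]mul1mx -(mulVmx (spectral_unit MC)) -mulmxA -/P -/y y0 mulmx0.
  by rewrite map_mx_eq0.
suff : 0 < toC (mxform M x x) by rewrite ltcR.
rewrite formE (bigD1 i) //= ltr_wpDr //.
  by apply: sumr_ge0 => j _; rewrite mulr_ge0 ?exprn_ge0 // ltW.
by rewrite mulr_gt0 // exprn_gt0 // normr_gt0.
Qed.

Lemma pdmx_quad_ge0 (R : realType) (n : nat) (M : 'M[R]_n) (x : 'cV[R]_n) :
  pdmx M -> 0 <= mxform M x x.
Proof.
move=> Mpd; have [->|/(pdmx_quad_gt0 Mpd)/ltW//] := eqVneq x 0.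
by rewrite mxform0l.
Qed.

(** Writing q and b for the quadratic and bilinear forms of M, the inequality
    q (q(y) x - b(x, y) y) >= 0 expands to q(y) (q(x) q(y) - b(x, y)^2) >= 0. *)
Lemma pdmx_CauchySchwarz (R : realType) (n : nat) (M : 'M[R]_n)
    (x y : 'cV[R]_n) :
  pdmx M -> mxform M x y ^+ 2 <= mxform M x x * mxform M y y.
Proof.
move=> Mpd; have [Msym _] := Mpd.
have [->|y_neq0] := eqVneq y 0.
  by rewrite (mxformC _ _ Msym) !mxform0l mulr0 expr0n.
have qy := pdmx_quad_gt0 Mpd y_neq0.
have := @pdmx_quad_ge0 _ _ M (mxform M y y *: x + (- mxform M x y) *: y) Mpd.
rewrite mxform_comb // => q_ge0.
rewrite -subr_ge0 -(pmulr_rge0 _ qy); apply: le_trans q_ge0 _.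
by rewrite le_eqVlt; apply/orP; left; apply/eqP; ring.
Qed.

(** * Strict convexity of the square root of a shifted quadratic form *)

(** For a form Q with associated bilinear form B, take p = Q(u), q = Q(v) and
    b = B(u, v): the last hypothesis is Q(u - v) > 0. *)
Lemma sqrt_quad_convex (R : realType) (delta p q b t : R) :
  0 < delta -> 0 < t < 1 -> 0 <= p -> 0 <= q -> b ^+ 2 <= p * q ->
  0 < p - 2 * b + q ->
  Num.sqrt (delta ^+ 2
    + ((1 - t) ^+ 2 * p + 2 * ((1 - t) * t) * b + t ^+ 2 * q)) <
  (1 - t) * Num.sqrt (delta ^+ 2 + p) + t * Num.sqrt (delta ^+ 2 + q).
Proof.
move=> d0 /andP[t0 t1] p0 q0 bpq hpq.
have d2 : 0 < delta ^+ 2 by rewrite exprn_gt0.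
have s0 : 0 < 1 - t by rewrite subr_gt0.
have A0 : 0 < Num.sqrt (delta ^+ 2 + p) by rewrite sqrtr_gt0 ltr_wpDr.
have B0 : 0 < Num.sqrt (delta ^+ 2 + q) by rewrite sqrtr_gt0 ltr_wpDr.
have A2 : Num.sqrt (delta ^+ 2 + p) ^+ 2 = delta ^+ 2 + p.
  by rewrite sqr_sqrtr // addr_ge0 // ltW.
have B2 : Num.sqrt (delta ^+ 2 + q) ^+ 2 = delta ^+ 2 + q.
  by rewrite sqr_sqrtr // addr_ge0 // ltW.
move: (Num.sqrt (delta ^+ 2 + p)) (Num.sqrt (delta ^+ 2 + q)) A0 B0 A2 B2.
move=> A B A0 B0 A2 B2.
have AB0 : 0 < A * B by rewrite mulr_gt0.
have main : delta ^+ 2 + b < A * B.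
  rewrite ltNge; apply/negP => ABle.
  have : (A * B) ^+ 2 <= (delta ^+ 2 + b) ^+ 2.
    by rewrite ler_sqr ?nnegrE ?(le_trans _ ABle) // ltW.
  apply/negP; rewrite -ltNge exprMn A2 B2 -subr_gt0.
  have -> : (delta ^+ 2 + p) * (delta ^+ 2 + q) - (delta ^+ 2 + b) ^+ 2 =
    delta ^+ 2 * (p - 2 * b + q) + (p * q - b ^+ 2) by ring.
  by rewrite ltr_wpDr ?mulr_gt0 // subr_ge0.
have C0 : 0 < (1 - t) * A + t * B by rewrite addr_gt0 ?mulr_gt0.
rewrite -[ltRHS]ger0_norm ?ltW // -sqrtr_sqr ltr_sqrt ?exprn_gt0 //.
have -> : ((1 - t) * A + t * B) ^+ 2 =
  (1 - t) ^+ 2 * A ^+ 2 + 2 * ((1 - t) * t) * (A * B) + t ^+ 2 * B ^+ 2 by ring.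
rewrite A2 B2 -subr_gt0.
set r := (X in 0 < X).
have -> : r = 2 * ((1 - t) * t) * (A * B - (delta ^+ 2 + b)).
  by rewrite /r; ring.
by rewrite !mulr_gt0 // subr_gt0.
Qed.

(** * Strict concavity of f *)

Lemma strictly_concave_midpoint (R : realType) (n : nat) (f : 'cV[R]_n -> R)
    (x y : 'cV[R]_n) :
  strictly_concave f -> y != 0 -> f x + f (x + y) < 2 * f (x + 2^-1 *: y).
Proof.
move=> fconc y_neq0.
have x_neq : x != x + y by rewrite -subr_eq0 opprD addNKr oppr_eq0.
have half : 0 < (2^-1 : R) < 1 by apply/andP; split; lra.
have := fconc x (x + y) 2^-1 x_neq half.
rewrite scalerDr addrA -scalerDl subrK scale1r; lra.
Qed.

Unset Implicit Arguments.

Theorem mainTheorem3 (R : realType) (n : nat) (n_gt0 : (0 < n)%N)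
    (c xs : 'cV[R]_n) (d delta : R) (delta_ge0 : 0 <= delta)
    (M : 'M[R]_n) (M_psd : psdmx M) (f : 'cV[R]_n -> R)
    (fE : forall x : 'cV[R]_n,
      f x = (c^T *m x) ord0 ord0 + d
            - Num.sqrt (delta ^+ 2 + ((x - xs)^T *m M *m (x - xs)) ord0 ord0)) :
  strictly_concave f <-> (pdmx M /\ 0 < delta).
Proof.
have {}fE x : f x = (c^T *m x) ord0 ord0 + d
    - Num.sqrt (delta ^+ 2 + mxform M (x - xs) (x - xs)) by exact: fE.
have linD x y : (c^T *m (x + y)) ord0 ord0 =
    (c^T *m x) ord0 ord0 + (c^T *m y) ord0 ord0 by rewrite mulmxDr mxE.
have linZ a x : (c^T *m (a *: x)) ord0 ord0 = a * (c^T *m x) ord0 ord0.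
  by rewrite -scalemxAr mxE.
split=> [fconc | [Mpd delta_gt0] x0 x1 t x01 t01].
- have [Msym M_ge0] := M_psd.
  (* strict concavity between xs and xs + y, tested at the midpoint *)
  have strict y : y != 0 ->
      2 * Num.sqrt (delta ^+ 2 + 2^-1 ^+ 2 * mxform M y y) <
      Num.sqrt (delta ^+ 2) + Num.sqrt (delta ^+ 2 + mxform M y y).
    move=> /(strictly_concave_midpoint xs fconc).
    rewrite !fE subrr mxform0l addr0 !(addrC xs) !addrK !(mxformZl, mxformZr).
    rewrite mulrA -expr2 !(linD, linZ); lra.
  split.
    split=> // a a_eig; rewrite lt_neqAle M_ge0 // andbT eq_sym.
    apply/eqP => a0; move: a_eig; rewrite a0 => /eigenvalueP[v vM v_neq0].
    have vt_neq0 : v^T != 0 by rewrite -(inj_eq trmx_inj) trmxK trmx0.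
    have := strict _ vt_neq0.
    rewrite /mxform trmxK vM scale0r mul0mx mxE mulr0 addr0; lra.
  (* when delta = 0 the square root is exactly halved at the midpoint, so any
     nonzero vector contradicts strictness *)
  rewrite lt_neqAle delta_ge0 andbT eq_sym; apply/eqP => delta0.
  have y_neq0 : (const_mx 1 : 'cV[R]_n) != 0.
    apply/eqP => /matrixP /(_ (Ordinal n_gt0) 0).
    by rewrite !mxE => /eqP; rewrite oner_eq0.
  have := strict _ y_neq0.
  rewrite delta0 expr0n /= !add0r sqrtr0 sqrtrM ?sqr_ge0 // sqrtr_sqr.
  by rewrite ger0_norm ?invr_ge0 // mulrA mulfV ?pnatr_eq0 // mul1r add0r ltxx.
- have [Msym _] := Mpd.
  set u := x0 - xs; set v := x1 - xs.
  have uv : (1 - t) *: x0 + t *: x1 - xs = (1 - t) *: u + t *: v.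
    rewrite /u /v !scalerBr addrACA -opprD -scalerDl subrK scale1r //.
  (* u - v, written as a combination to which mxform_comb applies *)
  have uv_neq0 : 1 *: u + (-1) *: v != 0.
    by rewrite scale1r scaleN1r /u /v opprB addrA subrK subr_eq0.
  have := pdmx_quad_gt0 Mpd uv_neq0.
  rewrite mxform_comb // => quv.
  have := sqrt_quad_convex delta_gt0 t01 (pdmx_quad_ge0 u Mpd)
    (pdmx_quad_ge0 v Mpd) (pdmx_CauchySchwarz u v Mpd).
  rewrite !fE uv mxform_comb // -/u -/v !(linD, linZ) => h.
  have {}h := h ltac:(lra); lra.
Qed.
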